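(* Let $p$ be a prime and let $a,b$ be nonzero integers such that the binary cubic form $C(x,y)=ax^3+by^3$ is primitive (i.e. $\gcd(a,b)=1$). If $C$ is anisotropic modulo $p$, then $R(C)$ is not dense in $\mathbb{Q}_p$.
   Context: For a cubic form $C$ in $r$ variables with integer coefficients, the ratio set is $R(C)=\{C(\overline{x})/C(\overline{y}) : \overline{x},\overline{y}\in\mathbb{Z}^r,\ C(\overline{y})\neq 0\}\subseteq\mathbb{Q}$, and density is with respect to the $p$-adic topology on $\mathbb{Q}_p$. The form $C$ is anisotropic modulo $p$ if there is no $(x,y)\in\mathbb{Z}^2$ with $(x,y)\not\equiv(0,0)\pmod p$ and $C(x,y)\equiv 0\pmod p$. *)

(* Defs.v *)
From HB Require Import structures.
From mathcomp Require Import all_boot all_order all_algebra.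
From mathcomp Require Import generic_quotient ring_quotient.
From mathcomp Require Import all_classical topology normedtype.

Set Implicit Arguments.
Unset Strict Implicit.
Unset Printing Implicit Defensive.

Import Order.TTheory GRing.Theory Num.Theory numFieldNormedType.Exports.
Local Open Scope classical_set_scope.
Local Open Scope ring_scope.
Local Open Scope quotient_scope.

(* logn p is identically 0 when p is not prime, so that padic_norm p is then
   the trivial absolute value and the construction of Qp p below makes sense
   for every p : nat; only the case of a prime p is meaningful. *)
Definition padic_norm (p : nat) (x : rat) : rat :=
  if x == 0 then 0
  else p%:R ^ ((logn p `|denq x|%N)%:Z - (logn p `|numq x|%N)%:Z).

Section PadicNorm.
Variable p : nat.
Local Notation pnorm := (padic_norm p).

Lemma padic_norm0 : pnorm 0 = 0.
Proof. by rewrite /padic_norm eqxx. Qed.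

Lemma padic_norm_nprime x : ~~ prime p -> pnorm x = (x != 0)%:R.
Proof.
move=> np; rewrite /padic_norm; case: eqP => //= _.
have L n : logn p n = 0%N by rewrite lognE (negbTE np).
by rewrite !L subrr expr0z.
Qed.

Lemma padic_norm_frac (m n : int) : prime p -> m != 0 -> n != 0 ->
  pnorm (m%:~R / n%:~R) = p%:R ^ ((logn p `|n|%N)%:Z - (logn p `|m|%N)%:Z).
Proof.
move=> pp m0 n0; set x := _ / _.
have nR0 : (n%:~R : rat) != 0 by rewrite intr_eq0.
have x0 : x != 0 by rewrite mulf_neq0 ?invr_eq0 ?intr_eq0.
rewrite /padic_norm (negbTE x0); congr (_ ^ _).
have E : (numq x * n)%R = (m * denq x)%R.
  apply/eqP; rewrite -(@eqr_int rat) !rmorphM /=; apply/eqP.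
  have dx0 : ((denq x)%:~R : rat) != 0 by rewrite intr_eq0 denq_neq0.
  have H : (numq x)%:~R / (denq x)%:~R = m%:~R / n%:~R :> rat.
    by rewrite divq_num_den.
  by apply/eqP; rewrite -(eqr_div _ _ dx0 nR0); apply/eqP.
have /(congr1 (fun z : int => logn p `|z|%N)) := E.
rewrite !abszM !lognM ?absz_gt0 ?denq_neq0 ?numq_eq0 // => /(congr1 Posz).
rewrite !PoszD => H.
by apply/eqP; rewrite subr_eq addrAC eq_sym subr_eq addrC H addrC.
Qed.

Lemma padic_norm_gt0 x : x != 0 -> 0 < pnorm x.
Proof.
move=> x0; case: (boolP (prime p)) => [pp|/padic_norm_nprime ->]; last by rewrite x0.
by rewrite /padic_norm (negbTE x0) exprz_gt0 // ltr0n prime_gt0.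
Qed.

Lemma padic_norm_ge0 x : 0 <= pnorm x.
Proof. by have [->|/padic_norm_gt0/ltW//] := eqVneq x 0; rewrite padic_norm0. Qed.

Lemma padic_norm1 : pnorm 1 = 1.
Proof. by rewrite /padic_norm oner_eq0 /= !logn1 subrr expr0z. Qed.

Lemma padic_normM x y : pnorm (x * y) = pnorm x * pnorm y.
Proof.
have [->|x0] := eqVneq x 0; first by rewrite mul0r padic_norm0 mul0r.
have [->|y0] := eqVneq y 0; first by rewrite mulr0 padic_norm0 mulr0.
case: (boolP (prime p)) => [pp|np]; last first.
  by rewrite !padic_norm_nprime // mulf_neq0 // x0 y0 mulr1.
have nx : numq x != 0 by rewrite numq_eq0.
have ny : numq y != 0 by rewrite numq_eq0.
rewrite -[x in LHS]divq_num_den -[y in LHS]divq_num_den mulf_div -!rmorphM /=.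
rewrite padic_norm_frac ?mulf_neq0 ?denq_neq0 //.
rewrite /padic_norm (negbTE x0) (negbTE y0) -expfzDr ?pnatr_eq0 -?lt0n ?prime_gt0 //.
congr (_ ^ _); rewrite !abszM !lognM ?absz_gt0 ?denq_neq0 // !PoszD.
by rewrite opprD addrACA.
Qed.

Lemma padic_normN x : pnorm (- x) = pnorm x.
Proof. by rewrite /padic_norm oppr_eq0 numqN abszN denqN. Qed.

Lemma padic_normV x : pnorm x^-1 = (pnorm x)^-1.
Proof.
have [->|x0] := eqVneq x 0; first by rewrite !(invr0, padic_norm0).
apply: (mulfI (lt0r_neq0 (padic_norm_gt0 x0))).
by rewrite -padic_normM !mulfV ?padic_norm1 // lt0r_neq0 // padic_norm_gt0.
Qed.

Lemma padic_normD x y : pnorm (x + y) <= Num.max (pnorm x) (pnorm y).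
Proof.
have [->|x0] := eqVneq x 0; first by rewrite add0r le_max lexx orbT.
have [->|y0] := eqVneq y 0; first by rewrite addr0 le_max lexx.
have [->|xy0] := eqVneq (x + y) 0; first by rewrite padic_norm0 le_max padic_norm_ge0.
case: (boolP (prime p)) => [pp|np]; last first.
  by rewrite !padic_norm_nprime // x0 y0 xy0 maxxx.
have nx : numq x != 0 by rewrite numq_eq0.
have ny : numq y != 0 by rewrite numq_eq0.
have dx := denq_neq0 x; have dy := denq_neq0 y.
pose d := denq x * denq y; pose m := numq x * denq y; pose n := numq y * denq x.
have d0 : d != 0 by rewrite mulf_neq0.
have m0 : m != 0 by rewrite mulf_neq0.
have n0 : n != 0 by rewrite mulf_neq0.
have Ex : x = m%:~R / d%:~R.
  by rewrite !rmorphM /= -mulf_div divff ?mulr1 ?divq_num_den // intr_eq0.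
have Ey : y = n%:~R / d%:~R.
  rewrite !rmorphM /= [X in _ / X]mulrC -mulf_div divff ?mulr1 ?divq_num_den //.
  by rewrite intr_eq0.
have Exy : x + y = (m + n)%:~R / d%:~R by rewrite Ex Ey -mulrDl -rmorphD.
have mn0 : m + n != 0.
  by apply: contra_neq xy0 => mn; rewrite Exy mn mul0r.
rewrite Ex Ey -mulrDl -rmorphD /= !padic_norm_frac //.
have p1 : 1 < p%:R :> rat by rewrite ltr1n prime_gt1.
rewrite le_max !ler_eXz2l // !lerD2l !lerN2 !lez_nat -geq_min.
set k := minn _ _.
have : ((p ^ k)%N%:Z %| m + n)%Z.
  rewrite rpredD // dvdzE /= pfactor_dvdn ?absz_gt0 // /k; first exact: geq_minl.
  exact: geq_minr.
by rewrite dvdzE /= pfactor_dvdn // absz_gt0.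
Qed.

Lemma padic_norm_ult e x y : pnorm x < e -> pnorm y < e -> pnorm (x + y) < e.
Proof. by move=> hx hy; apply: le_lt_trans (padic_normD x y) _; rewrite gt_max hx. Qed.

Lemma padic_norm_ultB e x y : pnorm x < e -> pnorm y < e -> pnorm (x - y) < e.
Proof. by move=> hx hy; apply: padic_norm_ult => //; rewrite padic_normN. Qed.

Lemma padic_norm_eq x y : pnorm (x - y) < pnorm x -> pnorm y = pnorm x.
Proof.
move=> h; apply/eqP; rewrite eq_le; apply/andP; split.
  rewrite -[y in X in X <= _](subKr x); apply: le_trans (padic_normD _ _) _.
  by rewrite padic_normN ge_max lexx ltW.
rewrite leNgt; apply/negP => h2.
by have := padic_norm_ult h h2; rewrite subrK ltxx.
Qed.

Definition padic_cauchy : {pred (nat -> rat)} := fun u =>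
  `[< forall e : rat, 0 < e -> exists N : nat, forall m n : nat,
        (N <= m)%N -> (N <= n)%N -> pnorm (u m - u n) < e >].

Lemma padic_cauchy_bounded u : u \in padic_cauchy ->
  exists2 M, 0 < M & forall n, pnorm (u n) < M.
Proof.
move=> /asboolP/(_ 1 ltr01)[N hN].
exists (1 + pnorm (u N) + \sum_(i < N) pnorm (u i)).
  by rewrite !ltr_wpDr ?sumr_ge0 ?padic_norm_ge0 // => i _; exact: padic_norm_ge0.
move=> n; have [Nn|nN] := leqP N n.
  apply: ltr_wpDr; first by apply: sumr_ge0 => i _; exact: padic_norm_ge0.
  rewrite -[u n](subrK (u N)); apply: padic_norm_ult.
    by rewrite ltr_wpDr ?padic_norm_ge0 // hN.
  by rewrite ltrDr.
rewrite (bigD1 (Ordinal nN)) //= addrCA ltrDl ltr_wpDr //.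
  by apply: sumr_ge0 => i _; exact: padic_norm_ge0.
by rewrite ltr_wpDr // padic_norm_ge0.
Qed.

Lemma padic_cauchy_subring : subring_closed padic_cauchy.
Proof.
split=> [|u v /asboolP hu /asboolP hv|u v hu hv]; apply/asboolP => e e0.
- by exists 0%N => m n _ _; rewrite subrr padic_norm0.
- have [N1 h1] := hu e e0; have [N2 h2] := hv e e0; exists (maxn N1 N2) => m n.
  rewrite !geq_max => /andP[m1 m2] /andP[n1 n2].
  rewrite [X in pnorm X](_ : _ = (u m - u n) - (v m - v n)); last first.
    by rewrite [in LHS]opprD addrACA -opprD.
  by apply: padic_norm_ultB; [exact: h1|exact: h2].
have [M M0 hM] := padic_cauchy_bounded hu.
have [K K0 hK] := padic_cauchy_bounded hv.
have [N1 h1] := asboolW hu _ (divr_gt0 e0 K0).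
have [N2 h2] := asboolW hv _ (divr_gt0 e0 M0).
exists (maxn N1 N2) => m n; rewrite !geq_max => /andP[m1 m2] /andP[n1 n2].
rewrite [X in pnorm X](_ : _ = (u m - u n) * v m + u n * (v m - v n)); last first.
  by rewrite mulrBl mulrBr addrA subrK.
apply: padic_norm_ult; rewrite padic_normM.
  rewrite -[ltRHS](divfK (lt0r_neq0 K0)).
  by rewrite ltr_pM ?padic_norm_ge0 ?hK ?h1.
rewrite -[ltRHS](divfK (lt0r_neq0 M0)) [ltRHS]mulrC.
by rewrite ltr_pM ?padic_norm_ge0 ?hM ?h2.
Qed.

HB.instance Definition _ :=
  GRing.isSubringClosed.Build (nat -> rat) padic_cauchy padic_cauchy_subring.

Record cauchy_seq := CauchySeq {
  cauchy_seq_val :> nat -> rat;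
  cauchy_seqP : cauchy_seq_val \in padic_cauchy
}.

HB.instance Definition _ := [isSub for cauchy_seq_val].
HB.instance Definition _ := [Choice of cauchy_seq by <:].
HB.instance Definition _ := [SubChoice_isSubComNzRing of cauchy_seq by <:].

Definition null_seq : {pred cauchy_seq} := fun u =>
  `[< forall e : rat, 0 < e -> exists N : nat, forall n : nat,
        (N <= n)%N -> pnorm (u n) < e >].

Lemma null_seq_ideal : idealr_closed null_seq.
Proof.
split=> [||u v w /asboolP hv /asboolP hw].
- by apply/asboolP => e e0; exists 0%N => n _; rewrite padic_norm0.
- apply/asboolP => /(_ 1 ltr01)[N /(_ N (leqnn _))].
  by rewrite padic_norm1 ltxx.
apply/asboolP => e e0.
have [M M0 hM] := padic_cauchy_bounded (cauchy_seqP u).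
have [N1 h1] := hv _ (divr_gt0 e0 M0); have [N2 h2] := hw _ e0.
exists (maxn N1 N2) => n; rewrite geq_max => /andP[n1 n2].
apply: padic_norm_ult; last exact: h2.
rewrite padic_normM -[ltRHS](divfK (lt0r_neq0 M0)) [ltRHS]mulrC.
by rewrite ltr_pM ?padic_norm_ge0 ?hM ?h1.
Qed.

HB.instance Definition _ := isIdealr.Build cauchy_seq null_seq null_seq_ideal.

Definition Qp := {ideal_quot null_seq}.

HB.instance Definition _ := GRing.ComNzRing.on Qp.
HB.instance Definition _ := NzRingQuotient.on Qp.

Lemma null_seqP (u : cauchy_seq) : reflect (\pi_Qp u = 0) (u \in null_seq).
Proof.
apply: (iffP idP) => [h|/eqP h]; first apply/eqP.
  by rewrite -(rmorph0 (\pi_Qp)) -Quotient.idealrBE subr0.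
by move: h; rewrite -(rmorph0 (\pi_Qp)) -Quotient.idealrBE subr0.
Qed.

Lemma cauchy_seq_norm_cst (u : cauchy_seq) : u \notin null_seq ->
  exists N c, 0 < c /\ forall n, (N <= n)%N -> pnorm (u n) = c.
Proof.
move=> /asboolPn/existsNP[e /not_implyP[e0 /forallNP h]].
have [N hN] := asboolW (cauchy_seqP u) _ e0.
have /existsNP[n /not_implyP[Nn /negP]] := h N; rewrite -leNgt => hn.
exists N, (pnorm (u n)); split=> [|m Nm]; first exact: lt_le_trans hn.
by apply: padic_norm_eq; apply: lt_le_trans hn; exact: hN.
Qed.

Lemma cauchy_seq_inv (u : cauchy_seq) : u \notin null_seq ->
  (fun n => (u n)^-1) \in padic_cauchy.
Proof.
move=> /cauchy_seq_norm_cst[N [c [c0 hc]]]; apply/asboolP => e e0.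
have [K hK] := asboolW (cauchy_seqP u) _ (mulr_gt0 e0 (mulr_gt0 c0 c0)).
have nz n : (N <= n)%N -> u n != 0.
  move=> /hc h; apply/eqP => un; move: h; rewrite un padic_norm0 => h.
  by rewrite h ltxx in c0.
exists (maxn N K) => m n; rewrite !geq_max => /andP[m1 m2] /andP[n1 n2].
have -> : (u m)^-1 - (u n)^-1 = (u n - u m) / (u m * u n).
  rewrite mulrBl; congr (_ - _); rewrite invfM; last by rewrite mulrA divff ?mul1r ?nz.
  by rewrite mulrCA divff ?mulr1 ?nz.
rewrite padic_normM padic_normV padic_normM !hc // ltr_pdivrMr ?mulr_gt0 //.
exact: hK.
Qed.

Definition Qp_inv (x : Qp) : Qp :=
  if x == 0 then 0 else \pi_Qp (insubd 0 (fun n => (repr x n)^-1)).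

Lemma Qp_inv0 : Qp_inv 0 = 0.
Proof. by rewrite /Qp_inv eqxx. Qed.

Lemma Qp_mulVf (x : Qp) : x != 0 -> Qp_inv x * x = 1.
Proof.
move=> x0; rewrite /Qp_inv (negbTE x0) -[X in _ * X]reprK.
have nx : repr x \notin null_seq.
  by apply/negP => /null_seqP; rewrite reprK; apply/eqP.
set v := insubd _ _.
have vE n : v n = (repr x n)^-1.
  by rewrite -[v n]/(\val v n) /v val_insubd cauchy_seq_inv.
rewrite -rmorphM -(rmorph1 (\pi_Qp)); apply/eqP; rewrite -Quotient.idealrBE.
have [N [c [c0 hc]]] := cauchy_seq_norm_cst nx.
apply/asboolP => e e0; exists N => n /hc h.
rewrite -[_ n]/(v n * repr x n - 1) vE mulVf ?subrr ?padic_norm0 //.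
by apply/eqP => xn; move: h c0; rewrite xn padic_norm0 => <-; rewrite ltxx.
Qed.

HB.instance Definition _ := GRing.ComNzRing_isField.Build Qp Qp_mulVf Qp_inv0.

(* rat^o carries the usual topology. The limit exists in rat because the
   sequence of norms is eventually constant or tends to 0. *)
Definition Qp_abs (x : Qp) : rat := limn (fun n => pnorm (repr x n) : rat^o).

Lemma Qp_absP (x : Qp) : x != 0 ->
  0 < Qp_abs x /\
  exists N, forall n, (N <= n)%N -> pnorm (repr x n) = Qp_abs x.
Proof.
move=> x0.
have nx : repr x \notin null_seq.
  by apply/negP => /null_seqP; rewrite reprK; apply/eqP.
have [N [c [c0 hc]]] := cauchy_seq_norm_cst nx.
have -> : Qp_abs x = c; last by split=> //; exists N.
apply: (lim_near_cst (@norm_hausdorff _ rat^o)).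
by exists N => // n /= /hc.
Qed.

Lemma Qp_abs0 : Qp_abs 0 = 0.
Proof.
have /asboolP h : repr (0 : Qp) \in null_seq by apply/null_seqP; rewrite reprK.
apply: (cvg_lim (@norm_hausdorff _ rat^o)); apply/cvgrPdist_lt => e e0.
have [N hN] := h e e0; exists N => // n /= /hN.
by rewrite sub0r normrN ger0_norm ?padic_norm_ge0.
Qed.

Lemma Qp_abs_ge0 x : 0 <= Qp_abs x.
Proof.
have [->|/Qp_absP[/ltW//]] := eqVneq x 0; by rewrite Qp_abs0.
Qed.

Lemma Qp_abs_lt (u : cauchy_seq) (e : rat) : 0 < e ->
  Qp_abs (\pi_Qp u) < e <-> exists N, forall n, (N <= n)%N -> pnorm (u n) < e.
Proof.
move=> e0; set x := \pi_Qp u.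
have /asboolP/(_ _ e0)[K hK] : u - repr x \in null_seq.
  by apply/null_seqP; rewrite rmorphB /= reprK subrr.
have [x0|x0] := eqVneq x 0.
  rewrite x0 Qp_abs0; split=> // _.
  by have /null_seqP/asboolP/(_ _ e0) : \pi_Qp u = 0.
have [_ [N hN]] := Qp_absP x0.
split=> [h|[M hM]].
  exists (maxn K N) => n; rewrite geq_max => /andP[Kn Nn].
  rewrite -(subrK (repr x n) (u n)) padic_norm_ult ?hN //; exact: hK.
pose n := maxn K (maxn N M).
rewrite -(hN n); last by rewrite !leq_max leqnn /= orbT.
rewrite -[repr x n](subKr (u n)) padic_norm_ultB //.
  by rewrite hM // !leq_max leqnn !orbT.
by apply: hK; rewrite leq_max leqnn.
Qed.

Lemma Qp_absD x y : Qp_abs (x + y) <= Num.max (Qp_abs x) (Qp_abs y).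
Proof.
rewrite leNgt; apply/negP; rewrite gt_max => /andP[].
set e := Qp_abs (x + y) => hx hy.
have e0 : 0 < e by apply: le_lt_trans hx; exact: Qp_abs_ge0.
move: hx hy; rewrite -[X in Qp_abs X < _ -> _]reprK.
rewrite -[X in _ -> Qp_abs X < _ -> _]reprK => /(Qp_abs_lt _ e0)[N hN].
move=> /(Qp_abs_lt _ e0)[M hM].
suff : Qp_abs (\pi_Qp (repr x + repr y)) < e by rewrite rmorphD /= !reprK ltxx.
apply/(Qp_abs_lt _ e0); exists (maxn N M) => n; rewrite geq_max => /andP[Nn Mn].
by apply: padic_norm_ult; [exact: hN|exact: hM].
Qed.

Lemma Qp_absN x : Qp_abs (- x) = Qp_abs x.
Proof.
suff h y : Qp_abs (- y) <= Qp_abs y.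
  by apply/eqP; rewrite eq_le h -[X in Qp_abs X <= _]opprK h.
rewrite leNgt; apply/negP; set e := Qp_abs (- y) => hy.
have e0 : 0 < e by apply: le_lt_trans hy; exact: Qp_abs_ge0.
move: hy; rewrite -[X in Qp_abs X < _ -> _]reprK => /(Qp_abs_lt _ e0)[N hN].
suff : Qp_abs (\pi_Qp (- repr y)) < e by rewrite rmorphN /= reprK ltxx.
apply/(Qp_abs_lt _ e0); exists N => n /hN.
by rewrite -[(- repr y : cauchy_seq) n]/(- (repr y n)) padic_normN.
Qed.

Definition Qp_dist (x y : Qp) : rat := Qp_abs (x - y).

Lemma Qp_distxx x : Qp_dist x x = 0.
Proof. by rewrite /Qp_dist subrr Qp_abs0. Qed.

Lemma Qp_dist_positivity x y : Qp_dist x y = 0 -> x = y.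
Proof.
move=> h; apply/eqP; rewrite -subr_eq0; apply/eqP; apply: contraPP h => /eqP.
by move=> /Qp_absP[h _]; apply/eqP; rewrite gt_eqF.
Qed.

Lemma Qp_dist_sym x y : Qp_dist x y = Qp_dist y x.
Proof. by rewrite /Qp_dist -opprB Qp_absN. Qed.

Lemma Qp_dist_triangle y x z : Qp_dist x z <= Qp_dist x y + Qp_dist y z.
Proof.
rewrite /Qp_dist -(subrK y x) -addrA addrK; apply: le_trans (Qp_absD _ _) _.
by rewrite ge_max lerDl lerDr !Qp_abs_ge0.
Qed.

HB.instance Definition _ := isMetric.Build rat Qp
  Qp_distxx Qp_dist_positivity Qp_dist_sym Qp_dist_triangle.

Lemma cst_cauchy (q : rat) : (fun=> q) \in padic_cauchy.
Proof. by apply/asboolP => e e0; exists 0%N => m n _ _; rewrite subrr padic_norm0. Qed.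

Definition Qp_of_rat (q : rat) : Qp := \pi_Qp (CauchySeq (cst_cauchy q)).

Lemma Qp_abs_of_rat q : Qp_abs (Qp_of_rat q) = pnorm q.
Proof.
have [->|q0] := eqVneq q 0.
  rewrite padic_norm0 -[RHS]Qp_abs0; congr Qp_abs; apply/null_seqP/asboolP => e e0.
  by exists 0%N => n _; rewrite padic_norm0.
apply/eqP; rewrite eq_le; apply/andP; split; rewrite leNgt; apply/negP => h.
  have e0 : 0 < Qp_abs (Qp_of_rat q) by apply: le_lt_trans h; exact: padic_norm_ge0.
  suff : Qp_abs (Qp_of_rat q) < Qp_abs (Qp_of_rat q) by rewrite ltxx.
  by apply/(Qp_abs_lt _ e0); exists 0%N.
by have [N /(_ N (leqnn N))] := (Qp_abs_lt _ (padic_norm_gt0 q0)).1 h; rewrite ltxx.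
Qed.

End PadicNorm.

(* A form in r variables is represented by the function it induces on integer
   row vectors. *)
Definition ratio_set (r : nat) (C : 'rV[int]_r -> int) : set rat :=
  [set q | exists x y : 'rV[int]_r,
             C y != 0 /\ q = (C x)%:~R / (C y)%:~R].

Definition anisotropic_mod (p : nat) (C : 'rV[int]_2 -> int) : Prop :=
  ~ exists v : 'rV[int]_2,
      ~ (forall i, (v ord0 i = 0 %[mod p])%Z) /\ (C v = 0 %[mod p])%Z.

Definition diag_binary_cubic (a b : int) (v : 'rV[int]_2) : int :=
  a * v ord0 ord0 ^+ 3 + b * v ord0 ord_max ^+ 3.

(* Main.v *)
(* Anisotropy gives a descent: if p divides C(v) then p divides both entries of
   v, so C(v) = p^3 C(v/p).  Hence the p-adic valuation of every nonzero value
   of C, and of every nonzero ratio, is a multiple of 3, whereas every p-adic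
   number close enough to p has valuation 1. *)
Require Import Defs.
From mathcomp Require Import all_boot all_order all_algebra.
From mathcomp Require Import all_classical topology.
From mathcomp Require Import zify.
Import Order.TTheory GRing.Theory Num.Theory.
Local Open Scope classical_set_scope.
Local Open Scope ring_scope.

Lemma diag_binary_cubicZ (a b c : int) (v : 'rV[int]_2) :
  diag_binary_cubic a b (c *: v) = c ^+ 3 * diag_binary_cubic a b v.
Proof. by rewrite /diag_binary_cubic !mxE !exprMn mulrDr !(mulrCA (c ^+ 3)). Qed.

(** Strong induction on the absolute value of the form at [v]. *)
Lemma dvd_logn_anisotropic (p : nat) (a b : int) (v : 'rV[int]_2) :
    prime p -> anisotropic_mod p (diag_binary_cubic a b) ->
    diag_binary_cubic a b v != 0 ->
  (3 %| logn p `|diag_binary_cubic a b v|)%N.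
Proof.
move=> pp hC; have [n] := ubnP `|diag_binary_cubic a b v|%N.
elim: n v => // n IH v; rewrite ltnS => vn v0.
have [pv|pNv] := boolP (p %| `|diag_binary_cubic a b v|)%N; last first.
  by rewrite lognE pp (negbTE pNv) andbF.
have hv : forall i, (v ord0 i = 0 %[mod p])%Z.
  apply: contrapT => hNv; apply: hC; exists v; split=> //.
  by rewrite mod0z; apply/dvdz_mod0P; rewrite dvdzE.
have {hv} [w vE] : exists w : 'rV[int]_2, v = p%:Z *: w.
  exists (\row_i (v ord0 i %/ p)%Z); apply/rowP => i; rewrite !mxE mulrC divzK //.
  by apply/dvdz_mod0P; rewrite hv mod0z.
move: v0 vn; rewrite vE diag_binary_cubicZ mulf_eq0 negb_or => /andP[_ w0].
rewrite abszM abszX absz_nat => wn.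
have w_gt0 : (0 < `|diag_binary_cubic a b w|)%N by rewrite absz_gt0.
have p3_gt0 : (0 < p ^ 3)%N by rewrite expn_gt0 prime_gt0.
rewrite lognM // pfactorK // dvdn_addr // IH //.
(* The measure drops strictly: the value at [w] is nonzero and [1 < p ^ 3]. *)
apply: leq_trans wn; rewrite -[ltnLHS]mul1n ltn_pmul2r //.
by rewrite (ltn_exp2l 0) // prime_gt1.
Qed.

Lemma Qp_of_ratB (p : nat) (x y : rat) :
  Qp_of_rat p (x - y) = Qp_of_rat p x - Qp_of_rat p y.
Proof. by rewrite -rmorphB; congr (\pi_(Qp p) _)%qT; exact: val_inj. Qed.

(** By the ultrametric inequality, the norm is constant on the open ball centred at [z] whose radius
    is the norm of [z], so this ball misses [S]. *)
Lemma not_dense_of_padic_norm_neq (p : nat) (S : set rat) (z : rat) :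
    z != 0 -> (forall q, S q -> padic_norm p q <> padic_norm p z) ->
  ~ dense (@Qp_of_rat p @` S).
Proof.
move=> z0 hS hD; have e0 := @padic_norm_gt0 p z z0.
pose B := ball (Qp_of_rat p z) (padic_norm p z).
(* Density is tested on the interior of [B], which is open by construction and contains the
   centre. *)
have [||x [/interior_subset xB [q Sq qx]]] := hD B°.
- by exists (Qp_of_rat p z); exact: nbhsx_ballx.
- exact: open_interior.
apply: (hS q Sq); apply: padic_norm_eq.
move: xB; rewrite /B ballEmdist /= -qx => xB.
by rewrite -Qp_abs_of_rat Qp_of_ratB.
Qed.

Theorem theorem1p1 (p : nat) (a b : int) (hp : prime p)
    (ha : a != 0) (hb : b != 0) (hab : gcdz a b = 1)
    (hC : anisotropic_mod p (diag_binary_cubic a b)) :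
  ~ dense (@Qp_of_rat p @` ratio_set (diag_binary_cubic a b)).
Proof.
have p0 : p != 0%N by rewrite -lt0n prime_gt0.
(* The point that ratios cannot approach is [p], written as a fraction to fit [padic_norm_frac]. *)
apply: (@not_dense_of_padic_norm_neq p _ (p%:Z%:~R / 1%:~R)).
  by rewrite divr1 intr_eq0.
move=> q [x [y [y0 ->]]]; rewrite [RHS]padic_norm_frac //.
(* The zero ratio has norm 0, whereas the norm of [p] is a power of [p]. *)
have [->|x0] := eqVneq (diag_binary_cubic a b x) 0.
  rewrite mul0r padic_norm0 => /esym/eqP; rewrite expfz_eq0 pnatr_eq0 (negbTE p0).
  by rewrite andbF.
rewrite padic_norm_frac // absz_nat (@pfactorK p 1) // logn1.
have p1 : 1 < p%:R :> rat by rewrite ltr1n prime_gt1.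
move=> /(ieexprIz (lt_trans ltr01 p1) (negbT (gt_eqF p1))).
have /dvdnP[k ->] := dvd_logn_anisotropic _ _ _ x hp hC x0.
have /dvdnP[l ->] := dvd_logn_anisotropic _ _ _ y hp hC y0.
(* Equal exponents would give [l * 3 - k * 3 = -1], impossible modulo 3. *)
lia.
Qed.
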